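(* Let $P$ be a named $\mathrm{GS4}$ derivation with conclusion $\vdash\Gamma,A$, where $A$ is a non-atomic named formula. Then $[\![\mathrm{isl}(P,A)]\!]\sqsubseteq[\![P]\!]$.
   Context: Named formulas and sequents. Fix a countably infinite set $\mathcal N$ of names and a set $\mathcal A$ of atoms with a fixpoint-free involution $\alpha\mapsto\bar\alpha$ ($\alpha\neq\bar\alpha$, $\bar{\bar\alpha}=\alpha$). Named formulas: $A,B::=\alpha^x\mid A\lor B\mid A\land B$ ($\alpha\in\mathcal A$, $x\in\mathcal N$); formulas $\alpha^x$ are atomic. Negation: $\overline{\alpha^x}=\bar\alpha^x$, $\overline{A\lor B}=\bar A\land\bar B$, $\overline{A\land B}=\bar A\lor\bar B$ (names are preserved). $\mathrm{names}(A)$ is the set of names in $A$, $\mathrm{names}(\Gamma)=\bigcup_{A\in\Gamma}\mathrm{names}(A)$. $A\equiv B$ means $A,B$ coincide after erasing names. A formula is sharing-free if each name occurs in it at most once; a set of formulas is sharing-free if its members are sharing-free with pairwise disjoint name sets. A sequent $\vdash\Gamma$ is a finite sharing-free set $\Gamma$; in comma notation $\vdash\Gamma,A,B$ the components have pairwise disjoint name sets and $\Gamma,A=\Gamma\cup\{A\}$. Derivations. Named $\mathrm{GS4}$ derivations are finite trees of rule applications, each labelled with a sharing-free sequent (its conclusion): axiom $\mathrm{ax}_{\{A,\bar B\}}$ (no premisses, conclusion $\vdash\Gamma,A,\bar B$, where $A\equiv B$; $A,\bar B$ are its principal formulas); cut (premisses $\vdash\Gamma,A$ and $\vdash\Gamma,\bar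 A$, conclusion $\vdash\Gamma$); superposition $\sqcup$ (premisses $\vdash\Gamma$, $\vdash\Gamma$, conclusion $\vdash\Gamma$); $\lor$ (premiss $\vdash\Gamma,A,B$, conclusion $\vdash\Gamma,A\lor B$); $\land$ (premisses $\vdash\Gamma,A$ and $\vdash\Gamma,B$, conclusion $\vdash\Gamma,A\land B$). Inversion and isolation. For $P$ with conclusion $\vdash\Gamma,A\lor B$, $\mathrm{inv}(P,A\lor B)$ (conclusion $\vdash\Gamma,A,B$) is defined by recursion on $P$: (1) if $P$ is an axiom with principal formulas $A\lor B$ and $\bar C\land\bar D$ ($A\equiv C$, $B\equiv D$, $\Gamma=\Delta,\bar C\land\bar D$), it is the $\land$ rule applied to $\mathrm{ax}_{\{\bar C,A\}}$ with conclusion $\vdash\Delta,\bar C,A,B$ and $\mathrm{ax}_{\{\bar D,B\}}$ with conclusion $\vdash\Delta,\bar D,A,B$; (2) if $P$ is $\mathrm{ax}_{\{C,\bar D\}}$ with conclusion $\vdash\Delta,C,\bar D,A\lor B$, it is $\mathrm{ax}_{\{C,\bar D\}}$ with conclusion $\vdash\Delta,C,\bar D,A,B$; (3) if $P$ ends with a $\lor$ rule introducing $A\lor B$ with premiss derivation $Q$, it is $Q$; (4) otherwise ($P$ ends with a cut, $\sqcup$, $\lor$ or $\land$ rule with $A\lor B$ in every premiss) apply the same last rule to the recursively inverted premiss derivations. For $P$ with conclusion $\vdash\Gamma,A\land B$, $\mathrm{inv}_l(P,A\land B)$ (conclusion $\vdash\Gamma,A$): (1) if $P$ is an axiom with principal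 formulas $A\land B$ and $\bar C\lor\bar D$ ($A\equiv C$, $B\equiv D$, $\Gamma=\Delta,\bar C\lor\bar D$), it is the $\lor$ rule applied to $\mathrm{ax}_{\{\bar C,A\}}$ with conclusion $\vdash\Delta,\bar C,\bar D,A$; (2) if $P$ is $\mathrm{ax}_{\{C,\bar D\}}$ with conclusion $\vdash\Delta,C,\bar D,A\land B$, it is $\mathrm{ax}_{\{C,\bar D\}}$ with conclusion $\vdash\Delta,C,\bar D,A$; (3) if $P$ ends with a $\land$ rule introducing $A\land B$ with premiss derivations $Q$ (of $\vdash\Gamma,A$) and $R$ (of $\vdash\Gamma,B$), it is $Q$; (4) otherwise recurse into all premisses and reapply the last rule. $\mathrm{inv}_r(P,A\land B)$ (conclusion $\vdash\Gamma,B$) is symmetric: in (1) it is the $\lor$ rule applied to $\mathrm{ax}_{\{\bar D,B\}}$ with conclusion $\vdash\Delta,\bar C,\bar D,B$; in (2) $A\land B$ is replaced by $B$; in (3) it is $R$. Then $\mathrm{isl}(P,A\lor B)$ is the $\lor$ rule applied to $\mathrm{inv}(P,A\lor B)$, and $\mathrm{isl}(P,A\land B)$ is the $\land$ rule applied to $\mathrm{inv}_l(P,A\land B)$ and $\mathrm{inv}_r(P,A\land B)$. Axiom graphs. A name graph is a simple graph $G=\langle V_G,E_G\rangle$ with $V_G\subseteq\mathcal N$ (edges $xy=\{x,y\}$). $H\sqsubseteq G$ iff $V_H\subseteq V_G$ and $E_H\subseteq E_G$; $\sqcup$ is componentwise union. $\mathrm{Wk}_\Gamma=\langle\mathrm{names}(\Gamma),\emptyset\rangle$.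 For disjoint sharing-free $A,\bar B$ with $A\equiv B$: $\mathrm{Id}_{\{\alpha^x,\bar\alpha^y\}}=\langle\{x,y\},\{xy\}\rangle$ and $\mathrm{Id}_{\{A_1\lor A_2,\bar B_1\land\bar B_2\}}=\mathrm{Id}_{\{A_1\land A_2,\bar B_1\lor\bar B_2\}}=\mathrm{Id}_{\{A_1,\bar B_1\}}\sqcup\mathrm{Id}_{\{A_2,\bar B_2\}}$. For name graphs $G,H$ and $I\subseteq\mathcal N$, an alternating path between $G$ and $H$ through $I$ is a sequence $x_1,\dots,x_n$ ($n>0$) of pairwise distinct vertices of $G$ or $H$ with $x_i\in I$ for $1<i<n$ and whose consecutive pairs $x_ix_{i+1}$ are edges alternately of $G$ and $H$ (odd ones in $G$ and even ones in $H$, or vice versa). $G\odot_I H$ has vertex set $(V_G\cup V_H)\setminus I$ and an edge $xy$ ($x\neq y$) iff some alternating path through $I$ goes from $x$ to $y$; $\odot_A$ means $\odot_{\mathrm{names}(A)}$. The axiom graph $[\![P]\!]$ is $\mathrm{Wk}_\Gamma\sqcup\mathrm{Id}_{\{A,\bar B\}}$ for an axiom $\mathrm{ax}_{\{A,\bar B\}}$ with conclusion $\vdash\Gamma,A,\bar B$; $[\![Q]\!]\odot_A[\![R]\!]$ for a cut with premiss derivations $Q$ of $\vdash\Gamma,A$ and $R$ of $\vdash\Gamma,\bar A$; and the union of the premiss derivations' axiom graphs for $\sqcup,\lor,\land$. *)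

(* Defs.v *)
From HB Require Import structures.
From mathcomp Require Import all_boot finmap.
From mathcomp Require Import boolp classical_sets cardinality.

Set Implicit Arguments.
Unset Strict Implicit.
Unset Printing Implicit Defensive.

Local Open Scope fset_scope.

Inductive form (At N : Type) : Type :=
| FAtom of At & N
| FOr of form At N & form At N
| FAnd of form At N & form At N.

Arguments FAtom {At N} _ _.

Section FormChoice.
Context {At N : choiceType}.

Fixpoint tree_of_form (A : form At N) : GenTree.tree (At * N) :=
  match A with
  | FAtom a x => GenTree.Leaf (a, x)
  | FOr A1 A2 => GenTree.Node 0 [:: tree_of_form A1; tree_of_form A2]
  | FAnd A1 A2 => GenTree.Node 1 [:: tree_of_form A1; tree_of_form A2]
  end.

Fixpoint form_of_tree (t : GenTree.tree (At * N)) : option (form At N) :=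
  match t with
  | GenTree.Leaf (a, x) => Some (FAtom a x)
  | GenTree.Node n [:: t1; t2] =>
      match form_of_tree t1, form_of_tree t2 with
      | Some A1, Some A2 => Some (if n == 0 then FOr A1 A2 else FAnd A1 A2)
      | _, _ => None
      end
  | _ => None
  end.

Lemma tree_of_formK : pcancel tree_of_form form_of_tree.
Proof. by elim=> [a x|A1 IH1 A2 IH2|A1 IH1 A2 IH2] //=; rewrite IH1 IH2. Qed.

HB.instance Definition _ := Choice.copy (form At N) (pcan_type tree_of_formK).

End FormChoice.

Section Formulas.
Context {At N : choiceType}.
Implicit Types (A B : form At N) (G : {fset form At N}).

Fixpoint neg (bar : At -> At) A : form At N :=
  match A with
  | FAtom a x => FAtom (bar a) x
  | FOr A1 A2 => FAnd (neg bar A1) (neg bar A2)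
  | FAnd A1 A2 => FOr (neg bar A1) (neg bar A2)
  end.

Definition atomic A : bool := if A is FAtom _ _ then true else false.

Fixpoint erase A : form At unit :=
  match A with
  | FAtom a _ => FAtom a tt
  | FOr A1 A2 => FOr (erase A1) (erase A2)
  | FAnd A1 A2 => FAnd (erase A1) (erase A2)
  end.

Definition eq_erase A B : Prop := erase A = erase B.

Fixpoint occs A : seq N :=
  match A with
  | FAtom _ x => [:: x]
  | FOr A1 A2 | FAnd A1 A2 => occs A1 ++ occs A2
  end.

Definition names A : {fset N} := [fset x in occs A].

Definition names_of G : {fset N} := \bigcup_(A <- G) names A.

Definition sharing_free A : bool := uniq (occs A).

Definition sharing_free_set G : Prop :=
  {in G, forall A, sharing_free A} /\
  {in G &, forall A B, A != B -> [disjoint names A & names B]}.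

(** [comma G [:: A1; ..; An]] is the set written [G, A1, .., An]; the side
    condition carried by that notation is [comma_ok G [:: A1; ..; An]]. *)

Definition comma G (s : seq (form At N)) : {fset form At N} :=
  G `|` [fset A in s].

Definition comma_ok G (s : seq (form At N)) : bool :=
  all (fun A => [disjoint names_of G & names A]) s &&
  pairwise (fun A B => [disjoint names A & names B]) s.

(** Raw trees store the parameters of each rule schema; [derivation] below
    selects the correct ones. [Ax G A Y] is the axiom with context [G] and
    principal formulas [A], [Y]; the pair is unordered in the mathematics, so
    everything defined on axioms treats [A] and [Y] symmetrically. *)

Inductive tree : Type :=
| Ax of {fset form At N} & form At N & form At N
| Cut of {fset form At N} & form At N & tree & tree
| Sup of {fset form At N} & tree & tree
| OrR of {fset form At N} & form At N & form At N & tree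
| AndR of {fset form At N} & form At N & form At N & tree & tree.

Definition concl (P : tree) : {fset form At N} :=
  match P with
  | Ax G A Y => comma G [:: A; Y]
  | Cut G _ _ _ => G
  | Sup G _ _ => G
  | OrR G A B _ => comma G [:: FOr A B]
  | AndR G A B _ _ => comma G [:: FAnd A B]
  end.

Definition has_concl (P : tree) G (s : seq (form At N)) : Prop :=
  comma_ok G s /\ concl P = comma G s.

Fixpoint derivation (bar : At -> At) (P : tree) : Prop :=
  sharing_free_set (concl P) /\
  match P with
  | Ax G A Y => has_concl P G [:: A; Y] /\
      exists2 B, Y = neg bar B & eq_erase A B
  | Cut G A Q R => [/\ has_concl Q G [:: A], has_concl R G [:: neg bar A],
      derivation bar Q & derivation bar R]
  | Sup G Q R => [/\ has_concl Q G [::], has_concl R G [::],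
      derivation bar Q & derivation bar R]
  | OrR G A B Q => [/\ has_concl P G [:: FOr A B], has_concl Q G [:: A; B] &
      derivation bar Q]
  | AndR G A B Q R => [/\ has_concl P G [:: FAnd A B], has_concl Q G [:: A],
      has_concl R G [:: B], derivation bar Q & derivation bar R]
  end.

(** [inv_or], [inv_l], [inv_r] and [isl] are total on raw trees; branches
    marked "junk" are unreachable on a derivation whose conclusion contains the formula. *)

(** [other F A Y] is the companion of [F] in the unordered pair [{A, Y}]. *)
Definition other (F A Y : form At N) : option (form At N) :=
  if F == A then Some Y else if F == Y then Some A else None.

(** Replace [F] by the formulas [s] in the sequent [G]. *)
Definition repl (F : form At N) (s : seq (form At N)) G : {fset form At N} :=
  comma (G `\ F) s.

Fixpoint inv_or (P : tree) (A B : form At N) : tree :=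
  let F := FOr A B in
  let rp := repl F [:: A; B] in
  match P with
  | Ax G X Y =>
      match other F X Y with
      | Some (FAnd C D) =>
          AndR (comma G [:: A; B]) C D
            (Ax (comma G [:: B]) C A) (Ax (comma G [:: A]) D B)
      | Some _ => P (* junk *)
      | None => Ax (rp G) X Y
      end
  | Cut G C Q R => Cut (rp G) C (inv_or Q A B) (inv_or R A B)
  | Sup G Q R => Sup (rp G) (inv_or Q A B) (inv_or R A B)
  | OrR G C D Q =>
      if FOr C D == F then Q else OrR (rp G) C D (inv_or Q A B)
  | AndR G C D Q R => AndR (rp G) C D (inv_or Q A B) (inv_or R A B)
  end.

Fixpoint inv_l (P : tree) (A B : form At N) : tree :=
  let F := FAnd A B in
  let rp := repl F [:: A] in
  match P with
  | Ax G X Y =>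
      match other F X Y with
      | Some (FOr C D) =>
          OrR (comma G [:: A]) C D (Ax (comma G [:: D]) C A)
      | Some _ => P (* junk *)
      | None => Ax (rp G) X Y
      end
  | Cut G C Q R => Cut (rp G) C (inv_l Q A B) (inv_l R A B)
  | Sup G Q R => Sup (rp G) (inv_l Q A B) (inv_l R A B)
  | OrR G C D Q => OrR (rp G) C D (inv_l Q A B)
  | AndR G C D Q R =>
      if FAnd C D == F then Q
      else AndR (rp G) C D (inv_l Q A B) (inv_l R A B)
  end.

Fixpoint inv_r (P : tree) (A B : form At N) : tree :=
  let F := FAnd A B in
  let rp := repl F [:: B] in
  match P with
  | Ax G X Y =>
      match other F X Y with
      | Some (FOr C D) =>
          OrR (comma G [:: B]) C D (Ax (comma G [:: C]) D B)
      | Some _ => P (* junk *)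
      | None => Ax (rp G) X Y
      end
  | Cut G C Q R => Cut (rp G) C (inv_r Q A B) (inv_r R A B)
  | Sup G Q R => Sup (rp G) (inv_r Q A B) (inv_r R A B)
  | OrR G C D Q => OrR (rp G) C D (inv_r Q A B)
  | AndR G C D Q R =>
      if FAnd C D == F then R
      else AndR (rp G) C D (inv_r Q A B) (inv_r R A B)
  end.

Definition isl (P : tree) (A : form At N) : tree :=
  match A with
  | FOr A1 A2 => OrR (concl P `\ A) A1 A2 (inv_or P A1 A2)
  | FAnd A1 A2 => AndR (concl P `\ A) A1 A2 (inv_l P A1 A2) (inv_r P A1 A2)
  | FAtom _ _ => P (* junk *)
  end.

End Formulas.

Arguments tree At N : clear implicits.

Record ngraph (N : Type) : Type := NGraph {
  vert : set N;
  edge : N -> N -> Prop;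
  edge_sym : forall x y, edge x y -> edge y x;
  edge_irr : forall x, ~ edge x x;
  edge_vert : forall x y, edge x y -> vert x }.

Section Graphs.
Context {N : choiceType}.
Implicit Types (G H : ngraph N) (I : set N).
Local Open Scope classical_set_scope.

Definition subgraph H G : Prop :=
  vert H `<=` vert G /\ (forall x y, edge H x y -> edge G x y).

#[local] Obligation Tactic := idtac.

Program Definition gunion G H : ngraph N :=
  {| vert := vert G `|` vert H; edge := fun x y => edge G x y \/ edge H x y |}.
Next Obligation. by move=> G H x y []; [left|right]; apply: edge_sym. Qed.
Next Obligation. by move=> G H x []; apply: edge_irr. Qed.
Next Obligation. by move=> G H x y []; [left|right]; apply: edge_vert; eassumption. Qed.

Program Definition discrete (V : set N) : ngraph N :=
  {| vert := V; edge := fun _ _ => False |}.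
Next Obligation. by []. Qed.
Next Obligation. by move=> V x. Qed.
Next Obligation. by []. Qed.

(** The complete graph on [{x, y}]: its only edge is [xy] when [x != y]. *)
Program Definition link (x y : N) : ngraph N :=
  {| vert := [set x; y];
     edge := fun u v => [/\ [set x; y] u, [set x; y] v & u <> v] |}.
Next Obligation. by move=> x y u v [hu hv /nesym]. Qed.
Next Obligation. by move=> x y u []. Qed.
Next Obligation. by move=> x y u v []. Qed.

(** The sequence is [x :: p]. Positions are counted from 0, so the first,
    third, .. consecutive pairs are those at even positions. *)
Definition alternating G H (x : N) (p : seq N) : Prop :=
  forall i, i < size p ->
    edge (if odd i then H else G) (nth x (x :: p) i) (nth x (x :: p) i.+1).

Definition alt_path G H I (x : N) (p : seq N) : Prop :=
  [/\ uniq (x :: p),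
      {in x :: p, forall z, (vert G `|` vert H) z},
      forall i, 0 < i < size p -> I (nth x (x :: p) i) &
      alternating G H x p \/ alternating H G x p].

Lemma rev_consE (x : N) p : rev (x :: p) = last x p :: rev (belast x p).
Proof. by rewrite lastI rev_rcons. Qed.

Lemma nth_rev_cons (x : N) p i : i <= size p ->
  nth (last x p) (last x p :: rev (belast x p)) i = nth x (x :: p) (size p - i).
Proof.
move=> le_ip; rewrite -rev_consE (set_nth_default x) ?size_rev //.
by rewrite nth_rev //= subSS.
Qed.

Lemma alternating_rev G H x p (q := rev (belast x p)) :
  alternating G H x p ->
  alternating G H (last x p) q \/ alternating H G (last x p) q.
Proof.
move=> alt; have szq : size q = size p by rewrite size_rev size_belast.
have step i : i < size p ->
    edge (if odd (size p - i.+1) then H else G)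
      (nth (last x p) (last x p :: q) i) (nth (last x p) (last x p :: q) i.+1).
  move=> lt_ip; rewrite !nth_rev_cons ?(ltnW lt_ip) //; apply: edge_sym.
  rewrite -(subnSK lt_ip); apply: alt.
  by rewrite ltn_subrL /= (leq_ltn_trans _ lt_ip).
case sp: (odd (size p)); [left|right] => i; rewrite szq => lt_ip;
  by have := step i lt_ip; rewrite oddB // sp /=; case: (odd i).
Qed.

Lemma alt_path_rev G H I x p : alt_path G H I x p ->
  exists2 q, alt_path G H I (last x p) q & last (last x p) q = x.
Proof.
move=> [Up Vp Ip alt]; exists (rev (belast x p)); last first.
  by case: p {Up Vp Ip alt} => //= y p; rewrite rev_cons last_rcons.
split.
- by rewrite -rev_consE rev_uniq.
- by move=> z; rewrite -rev_consE mem_rev; apply: Vp.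
- move=> i; rewrite size_rev size_belast => /andP[i_gt0 lt_ip].
  rewrite nth_rev_cons 1?ltnW //; apply: Ip.
  by rewrite subn_gt0 lt_ip ltn_subrL i_gt0 (leq_ltn_trans _ lt_ip).
- by case: alt => /alternating_rev[]; tauto.
Qed.

Program Definition gcomp I G H : ngraph N :=
  {| vert := (vert G `|` vert H) `\` I;
     edge := fun x y =>
       [/\ ((vert G `|` vert H) `\` I) x, ((vert G `|` vert H) `\` I) y, x <> y &
           exists2 p, alt_path G H I x p & last x p = y] |}.
Next Obligation.
by move=> I G H x y [Vx Vy /nesym nxy [p /alt_path_rev + eq_y]]; rewrite eq_y.
Qed.
Next Obligation. by move=> I G H x []. Qed.
Next Obligation. by move=> I G H x y []. Qed.

End Graphs.

Section AxiomGraphs.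
Context {At N : choiceType}.

Definition Wk (G : {fset form At N}) : ngraph N := discrete [set` names_of G].

(** The last branch is junk, never reached on the principal formulas of an
    axiom. *)
Fixpoint Id (A Y : form At N) : ngraph N :=
  match A, Y with
  | FAtom _ x, FAtom _ y => link x y
  | FOr A1 A2, FAnd Y1 Y2 | FAnd A1 A2, FOr Y1 Y2 =>
      gunion (Id A1 Y1) (Id A2 Y2)
  | _, _ => discrete set0
  end.

Fixpoint axiom_graph (P : tree At N) : ngraph N :=
  match P with
  | Ax G A Y => gunion (Wk G) (Id A Y)
  | Cut _ A Q R => gcomp [set` names A] (axiom_graph Q) (axiom_graph R)
  | Sup _ Q R => gunion (axiom_graph Q) (axiom_graph R)
  | OrR _ _ _ Q => axiom_graph Q
  | AndR _ _ _ Q R => gunion (axiom_graph Q) (axiom_graph R)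
  end.

End AxiomGraphs.

(* Main.v *)
(** Union and composition of name graphs are both monotone for inclusion, and an
    inversion leaves the last rule (in particular the cut formula) unchanged
    outside its base cases. So the inclusion [[inv P] ⊑ [P]] propagates through
    every rule, and only the axioms need an argument: there it amounts to the
    facts that [Id] is symmetric and that its vertices are all the names of its
    two formulas. *)

Require Import Defs.
From mathcomp Require Import all_boot finmap.
From mathcomp Require Import boolp classical_sets cardinality.

Set Implicit Arguments.
Unset Strict Implicit.
Unset Printing Implicit Defensive.

(** * Inclusion of name graphs; monotonicity of union and composition *)

Section NameGraphs.
Context {N : choiceType}.
Implicit Types (G H K : ngraph N) (I : set N).

Lemma subgraph_refl G : subgraph G G.
Proof. by split. Qed.

Lemma subgraph_trans H G K : subgraph G H -> subgraph H K -> subgraph G K.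
Proof.
by move=> [vGH eGH] [vHK eHK]; split=> [x /vGH /vHK|x y /eGH /eHK].
Qed.

Lemma subgraph_unionl G H : subgraph G (gunion G H).
Proof. by split=> [x|x y] ?; left. Qed.

Lemma subgraph_unionr G H : subgraph H (gunion G H).
Proof. by split=> [x|x y] ?; right. Qed.

Lemma gunion_sub G H K : subgraph G K -> subgraph H K -> subgraph (gunion G H) K.
Proof.
by move=> [vG eG] [vH eH]; split=> [x|x y] []; [exact: vG|exact: vH|exact: eG|exact: eH].
Qed.

Lemma gunion_mono G G' H H' :
  subgraph G G' -> subgraph H H' -> subgraph (gunion G H) (gunion G' H').
Proof.
move=> sG sH; apply: gunion_sub.
- exact: subgraph_trans sG (subgraph_unionl _ _).
- exact: subgraph_trans sH (subgraph_unionr _ _).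
Qed.

Lemma alternating_mono G G' H H' x p :
  subgraph G G' -> subgraph H H' -> alternating G H x p -> alternating G' H' x p.
Proof.
move=> [_ eG] [_ eH] alt i /alt; case: (odd i); [exact: eH|exact: eG].
Qed.

(** The same vertex sequence serves as witness: its edges and vertices survive in the larger graphs,
    and the condition on interior vertices mentions only [I], which is common to both sides. *)
Lemma gcomp_mono I G G' H H' :
  subgraph G G' -> subgraph H H' -> subgraph (gcomp I G H) (gcomp I G' H').
Proof.
move=> sG sH.
have sV : (vert (gunion G H) `<=` vert (gunion G' H'))%classic.
  by case: (gunion_mono sG sH).
split=> [x [/sV]|x y [[/sV Vx nIx] [/sV Vy nIy] nxy [p [Up Vp Ip alt] lp]]] //.
split=> //; exists p => //; split=> // [z /Vp /sV //|].
by case: alt => alt; [left|right]; apply: alternating_mono alt.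
Qed.

End NameGraphs.

(** * Identity graphs of matching pairs *)

Section IdGraphs.
Context {At N : choiceType}.
Local Open Scope fset_scope.
Implicit Types (A B C D F X Y : form At N) (G : {fset form At N}).

(** The shape shared by the pairs [A], [neg bar B] with [A] equal to [B] up to
    names; unlike that description it is visibly symmetric. *)
Fixpoint matching A Y : Prop :=
  match A, Y with
  | FAtom _ _, FAtom _ _ => True
  | FOr A1 A2, FAnd Y1 Y2 | FAnd A1 A2, FOr Y1 Y2 =>
      matching A1 Y1 /\ matching A2 Y2
  | _, _ => False
  end.

Lemma matching_neg (bar : At -> At) A B :
  eq_erase A B -> matching A (neg bar B).
Proof.
by elim: A B => [a x|A1 IH1 A2 IH2|A1 IH1 A2 IH2] [b y|B1 B2|B1 B2] //= [e1 e2];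
  split; auto.
Qed.

Lemma matching_sym A Y : matching A Y -> matching Y A.
Proof.
by elim: A Y => [a x|A1 IH1 A2 IH2|A1 IH1 A2 IH2] [b y|B1 B2|B1 B2] //= [/IH1 ? /IH2].
Qed.

Lemma Id_sym A Y : subgraph (Id A Y) (Id Y A).
Proof.
elim: A Y => [a x|A1 IH1 A2 IH2|A1 IH1 A2 IH2] [b y|B1 B2|B1 B2] /=;
  try exact: subgraph_refl; try exact: gunion_mono.
by split=> [u []|u v [[] -> [] -> nuv]] //; (try by [left|right]); split=> //;
  by [left|right].
Qed.

Lemma mem_names_or A B x : (x \in names (FOr A B)) = (x \in names A) || (x \in names B).
Proof. by rewrite !inE. Qed.

Lemma mem_names_and A B x : (x \in names (FAnd A B)) = (x \in names A) || (x \in names B).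
Proof. by rewrite !inE. Qed.

(** [matching] keeps the recursion away from the junk branch of [Id], where the graph is empty and
    names would be lost. *)
Lemma names_vert_Idl A Y x : matching A Y -> x \in names A -> vert (Id A Y) x.
Proof.
elim: A Y => [a y|A1 IH1 A2 IH2|A1 IH1 A2 IH2] [b z|B1 B2|B1 B2] //=.
- by rewrite !inE orbF => _ /eqP ->; left.
- by rewrite mem_names_or => -[m1 m2] /orP[/IH1|/IH2]; [left|right]; auto.
- by rewrite mem_names_and => -[m1 m2] /orP[/IH1|/IH2]; [left|right]; auto.
Qed.

Lemma names_vert_Idr A Y x : matching A Y -> x \in names Y -> vert (Id A Y) x.
Proof.
by move=> /matching_sym m /(names_vert_Idl m); case: (Id_sym Y A) => + _; apply.
Qed.

(** * Names of sequents and comparison of axioms *)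

Lemma names_ofP G x :
  reflect (exists2 A, A \in G & x \in names A) (x \in names_of G).
Proof.
by rewrite /names_of; apply: (iffP (bigfcupP _ _ _ _)) => -[A];
  rewrite ?andbT => AG xA; exists A; rewrite ?AG.
Qed.

Lemma mem_comma G s A : (A \in comma G s) = (A \in G) || (A \in s).
Proof. by rewrite !inE. Qed.

Lemma mem_names_comma G s x :
  (x \in names_of (comma G s)) =
  (x \in names_of G) || has (fun A => x \in names A) s.
Proof.
apply/names_ofP/orP => [[A]|[/names_ofP[A AG xA]|/hasP[A As xA]]].
- rewrite mem_comma => /orP[AG|As] xA; [left; apply/names_ofP|right; apply/hasP];
  by exists A.
- by exists A; rewrite // mem_comma AG.
- by exists A; rewrite // mem_comma As orbT.
Qed.

Lemma mem_names_repl F s G x : F \in G ->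
  (forall A, A \in s -> names A `<=` names F) ->
  x \in names_of (repl F s G) -> x \in names_of G.
Proof.
move=> FG sF; rewrite mem_names_comma.
case/orP=> [/names_ofP[A]|/hasP[A /sF/fsubsetP sA /sA xF]].
- by rewrite in_fsetD1 => /andP[_ AG] xA; apply/names_ofP; exists A.
- by apply/names_ofP; exists F.
Qed.

(** The context contributes isolated vertices only, so no edge condition arises from it. *)
Lemma axiom_graph_ax_sub G X Y (K : ngraph N) :
  (forall x, x \in names_of G -> vert K x) -> subgraph (Id X Y) K ->
  subgraph (axiom_graph (Ax G X Y)) K.
Proof. by move=> sG sI; apply: gunion_sub => //; split. Qed.

Lemma axiom_graph_repl F s G X Y : F \in G ->
  (forall A, A \in s -> names A `<=` names F) ->
  subgraph (axiom_graph (Ax (repl F s G) X Y)) (axiom_graph (Ax G X Y)).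
Proof.
move=> FG sF; apply: axiom_graph_ax_sub; last exact: subgraph_unionr.
by move=> x /(mem_names_repl FG sF); left.
Qed.

(** Meant for the axioms created by inverting a principal formula: [D] is the component that joins
    the context, and [K] the identity graph of the original pair, which already has the names of [D]
    as vertices. *)
Lemma axiom_graph_comma G D X Y (K : ngraph N) :
  (forall x, x \in names D -> vert K x) -> subgraph (Id X Y) K ->
  subgraph (axiom_graph (Ax (comma G [:: D]) X Y)) (gunion (Wk G) K).
Proof.
move=> sD sI; apply: axiom_graph_ax_sub; last first.
  exact: subgraph_trans sI (subgraph_unionr _ _).
by move=> x; rewrite mem_names_comma /= orbF => /orP[|/sD]; [left|right].
Qed.

(** Orients the unordered principal pair, so that the inverted formula may be taken to come
    first. *)
Lemma other_matching F X Y Z : matching X Y -> other F X Y = Some Z ->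
  matching F Z /\ subgraph (Id F Z) (Id X Y).
Proof.
rewrite /other => mXY; case: eqP => [-> [<-]|_].
  by split=> //; exact: subgraph_refl.
case: eqP => // -> [<-]; split; [exact: matching_sym|exact: Id_sym].
Qed.

Lemma other_None F G X Y :
  F \in concl (Ax G X Y) -> other F X Y = None -> F \in G.
Proof. rewrite /other mem_comma !inE.
by case: (F == X) => //; case: (F == Y) => //; rewrite !orbF. Qed.

End IdGraphs.

(** * Inversions do not enlarge the axiom graph *)

Section Inversion.
Context {At N : choiceType}.
Context (bar : At -> At).
Local Open Scope fset_scope.
Implicit Types (A B C D F X Y : form At N) (G : {fset form At N}).
Implicit Types (P Q R : tree At N).

Lemma derivation_ax G X Y : derivation bar (Ax G X Y) -> matching X Y.
Proof. by move=> [_ [_ [B -> /matching_neg]]]; apply. Qed.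

Lemma has_concl_mem P G s F : has_concl P G s -> F \in G -> F \in concl P.
Proof. by move=> [_ ->] FG; rewrite mem_comma FG. Qed.

Lemma mem_comma1 G X F : F != X -> F \in comma G [:: X] -> F \in G.
Proof. by rewrite mem_comma inE orbC => /negPf ->. Qed.

Lemma inv_or_sub P A B : derivation bar P -> FOr A B \in concl P ->
  subgraph (axiom_graph (inv_or P A B)) (axiom_graph P).
Proof.
elim: P => [G X Y|G C Q IHQ R IHR|G Q IHQ R IHR|G C D Q IHQ|G C D Q IHQ R IHR].
- move=> /derivation_ax mXY FP /=.
  case eqZ: (other _ X Y) => [Z|]; last first.
    apply: axiom_graph_repl; first exact: other_None FP eqZ.
    move=> Z; rewrite !inE => /orP[]/eqP->; apply/fsubsetP=> x xZ;
      by rewrite mem_names_or xZ ?orbT.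
  have [+ sI] := other_matching mXY eqZ.
  (* Only a conjunction matches a disjunction, which excludes the junk branch of [inv_or]. *)
  case: Z {eqZ} sI => //= C D sI [mAC mBD].
  apply: subgraph_trans (gunion_mono (subgraph_refl _) sI).
  apply: gunion_sub; apply: axiom_graph_comma.
  (* The names of [B], now in the context, are vertices of the other half [Id B D]. *)
  + by move=> x xB; right; apply: names_vert_Idl xB.
  + exact: subgraph_trans (Id_sym _ _) (subgraph_unionl _ _).
  + by move=> x xA; left; apply: names_vert_Idl xA.
  + exact: subgraph_trans (Id_sym _ _) (subgraph_unionr _ _).
- move=> [_ [cQ cR dQ dR]] FP; apply: gcomp_mono.
  + exact/IHQ/(has_concl_mem cQ).
  + exact/IHR/(has_concl_mem cR).
- move=> [_ [cQ cR dQ dR]] FP; apply: gunion_mono.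
  + exact/IHQ/(has_concl_mem cQ).
  + exact/IHR/(has_concl_mem cR).
- move=> [_ [_ cQ dQ]] FP /=.
  (* If the rule introduces the inverted formula, its premiss has the same graph; otherwise that
     formula lies in the context and hence in the premiss. *)
  case: eqP => [_|/eqP nF]; first exact: subgraph_refl.
  rewrite eq_sym in nF; have FG := mem_comma1 nF FP.
  exact/IHQ/(has_concl_mem cQ).
(* The inequality required by [mem_comma1] holds because the outermost connectives differ. *)
- move=> [_ [_ cQ cR dQ dR]] /mem_comma1 FG; apply: gunion_mono.
  + exact/IHQ/(has_concl_mem cQ)/FG.
  + exact/IHR/(has_concl_mem cR)/FG.
Qed.

(** Here edges can disappear: a principal axiom keeps only those of [Id A C], and a rule introducing
    [FAnd A B] loses its right premiss. In the axiom case [D] stays in the context, but its names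
    are vertices of [Id B D]. *)
Lemma inv_l_sub P A B : derivation bar P -> FAnd A B \in concl P ->
  subgraph (axiom_graph (inv_l P A B)) (axiom_graph P).
Proof.
elim: P => [G X Y|G C Q IHQ R IHR|G Q IHQ R IHR|G C D Q IHQ|G C D Q IHQ R IHR].
- move=> /derivation_ax mXY FP /=.
  case eqZ: (other _ X Y) => [Z|]; last first.
    apply: axiom_graph_repl; first exact: other_None FP eqZ.
    move=> Z; rewrite !inE => /eqP->; apply/fsubsetP=> x xZ.
    by rewrite mem_names_and xZ.
  have [+ sI] := other_matching mXY eqZ.
  case: Z {eqZ} sI => //= C D sI [mAC mBD].
  apply: subgraph_trans (gunion_mono (subgraph_refl _) sI).
  apply: axiom_graph_comma.
  + by move=> x xD; right; apply: names_vert_Idr xD.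
  + exact: subgraph_trans (Id_sym _ _) (subgraph_unionl _ _).
- move=> [_ [cQ cR dQ dR]] FP; apply: gcomp_mono.
  + exact/IHQ/(has_concl_mem cQ).
  + exact/IHR/(has_concl_mem cR).
- move=> [_ [cQ cR dQ dR]] FP; apply: gunion_mono.
  + exact/IHQ/(has_concl_mem cQ).
  + exact/IHR/(has_concl_mem cR).
- move=> [_ [_ cQ dQ]] /mem_comma1 FG.
  exact/IHQ/(has_concl_mem cQ)/FG.
- move=> [_ [_ cQ cR dQ dR]] FP /=.
  case: eqP => [_|/eqP nF]; first exact: subgraph_unionl.
  rewrite eq_sym in nF; have FG := mem_comma1 nF FP; apply: gunion_mono.
  + exact/IHQ/(has_concl_mem cQ).
  + exact/IHR/(has_concl_mem cR).
Qed.

Lemma inv_r_sub P A B : derivation bar P -> FAnd A B \in concl P ->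
  subgraph (axiom_graph (inv_r P A B)) (axiom_graph P).
Proof.
elim: P => [G X Y|G C Q IHQ R IHR|G Q IHQ R IHR|G C D Q IHQ|G C D Q IHQ R IHR].
- move=> /derivation_ax mXY FP /=.
  case eqZ: (other _ X Y) => [Z|]; last first.
    apply: axiom_graph_repl; first exact: other_None FP eqZ.
    move=> Z; rewrite !inE => /eqP->; apply/fsubsetP=> x xZ.
    by rewrite mem_names_and xZ orbT.
  have [+ sI] := other_matching mXY eqZ.
  case: Z {eqZ} sI => //= C D sI [mAC mBD].
  apply: subgraph_trans (gunion_mono (subgraph_refl _) sI).
  apply: axiom_graph_comma.
  (* The roles of the halves are exchanged: the names of [C] come from [Id A C], the edges from
     [Id B D]. *)
  + by move=> x xC; left; apply: names_vert_Idr xC.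
  + exact: subgraph_trans (Id_sym _ _) (subgraph_unionr _ _).
- move=> [_ [cQ cR dQ dR]] FP; apply: gcomp_mono.
  + exact/IHQ/(has_concl_mem cQ).
  + exact/IHR/(has_concl_mem cR).
- move=> [_ [cQ cR dQ dR]] FP; apply: gunion_mono.
  + exact/IHQ/(has_concl_mem cQ).
  + exact/IHR/(has_concl_mem cR).
- move=> [_ [_ cQ dQ]] /mem_comma1 FG.
  exact/IHQ/(has_concl_mem cQ)/FG.
- move=> [_ [_ cQ cR dQ dR]] FP /=.
  case: eqP => [_|/eqP nF]; first exact: subgraph_unionr.
  rewrite eq_sym in nF; have FG := mem_comma1 nF FP; apply: gunion_mono.
  + exact/IHQ/(has_concl_mem cQ).
  + exact/IHR/(has_concl_mem cR).
Qed.

End Inversion.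

Theorem theorem1 (N : choiceType)
    (N_countably_infinite : ([set: N] #= [set: nat])%card)
    (At : choiceType) (bar : At -> At)
    (bar_neq : forall a : At, a <> bar a) (barK : involutive bar)
    (P : tree At N) (G : {fset form At N}) (A : form At N) :
  derivation bar P -> has_concl P G [:: A] -> ~~ atomic A ->
  subgraph (axiom_graph (isl P A)) (axiom_graph P).
Proof.
move=> dP [_ cP]; have: A \in concl P by rewrite cP mem_comma inE eqxx orbT.
(* The final [OrR] leaves the graph of its premiss unchanged, whereas the final [AndR] takes the
   union of two graphs that each lie in that of [P]. *)
case: A {cP} => //= A B AP _; first exact: inv_or_sub dP AP.
by apply: gunion_sub; [exact: inv_l_sub dP AP|exact: inv_r_sub dP AP].
Qed.
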